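(* Let $\lambda,\mu,\theta,\gamma>0$, $p\in[0,1]$, $c^*=\frac{\lambda}{\mu}+\frac{\lambda p}{\gamma}$, $\epsilon\in(0,1)$ and $z_\epsilon=\overline{\Phi}^{-1}(\epsilon)$. For a staffing level $c>0$, consider the joint-normal delay equation $$\overline{\Phi}\left(\frac{s^*-q^*}{\sqrt{v_{qq}+v_{ss}-2v_{qs}}}\right)=\epsilon,\qquad(\ast)$$ where $q^*,s^*,v_{qq},v_{ss},v_{qs}$ are the regime-specific functions of $c$ given in the context (underloaded formulas for $c>c^*$, overloaded formulas for $c<c^*$), and write $\mathrm{Var}(Q-S)=v_{qq}+v_{ss}-2v_{qs}$. (a) Underloaded regime ($\epsilon<1/2$). Here $s^*-q^*=c-c^*$ and $\mathrm{Var}(Q-S)=\frac{\lambda}{\mu}+\frac{\lambda p}{\gamma}=c^*$, and the required staffing level, i.e. the solution of $(\ast)$ with the underloaded formulas, is $$c_\epsilon=c^*+z_\epsilon\sqrt{c^*}=\frac{\lambda}{\mu}+\frac{\lambda p}{\gamma}+z_\epsilon\sqrt{\frac{\lambda}{\mu}+\frac{\lambda p}{\gamma}}.$$ Because $z_\epsilon>0$, this solution satisfies $c_\epsilon>c^*$. (b) Overloaded regime ($\epsilon>1/2$). Let $$\kappa=\frac{\gamma}{\gamma+p\mu},\qquad U_A=\frac{\gamma p\mu^2[\mu(1-p)-\gamma]}{\theta(\gamma+p\mu)^2(\theta+\gamma+p\mu)}.$$ Then, with the overloaded formulas, $$s^*-q^*=\frac{\mu\kappa c-\lambda}{\theta},\qquad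 \mathrm{Var}(Q-S)=\frac{\lambda}{\theta}+U_Ac.$$ If $\lambda>\theta z_\epsilon^2$, the feasible staffing level (the solution $c\in(0,c^* )$ of $(\ast)$ with the overloaded formulas) is the smaller root of $$\mu^2\kappa^2c^2-\left(2\lambda\mu\kappa+z_\epsilon^2\theta^2U_A\right)c+\lambda(\lambda-\theta z_\epsilon^2)=0.$$ Equivalently, $$c_\epsilon=\frac{A_\epsilon-\sqrt{A_\epsilon^2-4\mu^2\kappa^2\lambda(\lambda-\theta z_\epsilon^2)}}{2\mu^2\kappa^2},\qquad A_\epsilon=2\lambda\mu\kappa+z_\epsilon^2\theta^2U_A,$$ and $0<c_\epsilon<c^*$.
   Context: $\Phi$ is the standard normal distribution function, $\overline\Phi=1-\Phi$, and $\overline\Phi^{-1}$ is the inverse function of $\overline\Phi$. The left side of $(\ast)$ is the probability $\Pr(Q\ge S)$ when $(Q,S)$ is bivariate normal with mean $(q^*,s^* )$ and covariance matrix $\begin{pmatrix}v_{qq}&v_{qs}\\ v_{qs}&v_{ss}\end{pmatrix}$. Underloaded formulas: $q^*=\frac{\lambda}{\mu}$, $s^*=c-\frac{\lambda p}{\gamma}$, $v_{qq}=\frac{\lambda}{\mu}$, $v_{ss}=\frac{\lambda p}{\gamma}$, $v_{qs}=0$. Overloaded formulas: $s^*=\frac{\gamma c}{\gamma+p\mu}$, $q^*=\frac{\lambda-\mu s^*}{\theta}+s^*$, $$v_{ss}=\frac{c\gamma p\mu}{(\gamma+p\mu)^2},\qquad v_{qs}=\frac{c\gamma p\mu}{(\gamma+p\mu)^2}\cdot\frac{\gamma+\theta+p\mu-\mu}{\theta+\gamma+p\mu},\qquad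 v_{qq}=\frac{\lambda}{\theta}+\frac{\theta-\mu}{\theta}\,v_{qs}.$$ *)

(* Defs.v *)
From HB Require Import structures.
From mathcomp Require Import all_boot all_order all_algebra.
From mathcomp Require Import all_classical all_reals all_analysis.

Set Implicit Arguments.
Unset Strict Implicit.
Unset Printing Implicit Defensive.

Import Order.TTheory GRing.Theory Num.Theory.
Import numFieldNormedType.Exports.

Local Open Scope classical_set_scope.
Local Open Scope ring_scope.

Section standard_normal.
Context {R : realType}.

Definition Phi (x : R) : R := fine (normal_prob 0 1 `]-oo, x]).

Definition Phibar (x : R) : R := 1 - Phi x.

(* Values outside the range ]0, 1[ of Phibar are sent to 0. *)
Definition Phibar_inv : R -> R := 'pinv_(fun=> 0) [set: R] Phibar.

End standard_normal.

(* Means and covariances of the pair (Q, S) in the normal approximation. *)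
Record moments (R : realType) := Moments {
  qstar : R; sstar : R;
  v_qq : R; v_ss : R; v_qs : R }.

Section staffing.
Context {R : realType}.
Implicit Types (lambda mu theta gamma p c eps : R) (m : moments R).

Definition underloaded lambda mu gamma p c : moments R := {|
  qstar := lambda / mu;
  sstar := c - lambda * p / gamma;
  v_qq := lambda / mu;
  v_ss := lambda * p / gamma;
  v_qs := 0 |}.

Definition overloaded lambda mu theta gamma p c : moments R :=
  let s := gamma * c / (gamma + p * mu) in
  let vss := c * gamma * p * mu / (gamma + p * mu) ^+ 2 in
  let vqs := c * gamma * p * mu / (gamma + p * mu) ^+ 2
             * ((gamma + theta + p * mu - mu) / (theta + gamma + p * mu)) in
  {| qstar := (lambda - mu * s) / theta + s;
     sstar := s;
     v_qq := lambda / theta + (theta - mu) / theta * vqs;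
     v_ss := vss;
     v_qs := vqs |}.

Definition var_diff m : R := v_qq m + v_ss m - 2 * v_qs m.

Definition delay_equation eps m : Prop :=
  Phibar ((sstar m - qstar m) / Num.sqrt (var_diff m)) = eps.

End staffing.

(* Main.v *)
From HB Require Import structures.
Require Import Defs.
From mathcomp Require Import all_boot all_order all_algebra.
From mathcomp Require Import all_classical all_reals all_analysis.
From mathcomp Require Import ring lra.

(** Because [Phibar] is a strictly decreasing bijection from the reals onto
    the open unit interval, the delay equation says exactly that the
    standardized mean [(sstar - qstar) / sqrt var_diff] is the quantile [z], and
    because [Phibar 0 = 1 / 2], the sign of [z] is that of [1 / 2 - eps].

    In the underloaded regime the variance does not depend on [c] and the
    mean is affine in [c], so the equation is linear.

    In the overloaded regime put [m = mu * kappa]; then [cstar = lambda / m],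
    the mean is [(m * c - lambda) / theta], negative exactly below [cstar],
    and the variance [V c = lambda / theta + U * c] is affine.  It is positive
    at [0] and at [cstar], hence in between.  On this interval the mean and
    [z] are both negative, so the equation may be squared without adding
    solutions, and it becomes [quad c = 0] for
    [quad c = (m * c - lambda) ^+ 2 - (z * theta) ^+ 2 * V c].  Now [quad] is
    a convex parabola with [quad 0 > 0], which is the feasibility condition
    [theta * z ^+ 2 < lambda], and [quad cstar < 0], since only the variance
    term survives at [cstar].  Therefore exactly one of its roots, the smaller
    one, lies between [0] and [cstar].

    The two facts carrying this are [Phibar_eq] on the analytic side and
    [quadratic_roots_separated] on the algebraic side. *)

Set Implicit Arguments.
Unset Strict Implicit.
Unset Printing Implicit Defensive.

Import Order.TTheory GRing.Theory Num.Theory.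
Import numFieldNormedType.Exports.

Local Open Scope ring_scope.

(** * The standard normal distribution function *)

Section standard_normal_cdf.
Variable R : realType.
Local Open Scope classical_set_scope.
Implicit Types x y : R.

Lemma std_normal_pdf_gt0 x : 0 < normal_pdf 0 1 x.
Proof.
rewrite normal_pdfE ?oner_neq0// mulr_gt0 ?expR_gt0//.
by rewrite normal_peak_gt0// oner_neq0.
Qed.

(** [Phi] is the integral of the normal density from [-oo]; the density is
    continuous, so the fundamental theorem of calculus applies at every point. *)
Lemma Phi_derivative x : derivable (@Phi R) x 1 /\ (@Phi R)^`() x = normal_pdf 0 1 x.
Proof.
apply: (@continuous_FTC1 R (normal_pdf 0 1) -oo%O x (x + 1)).
- by rewrite ltrDl.
- apply: integrableS (integrable_normal_pdf 0 1) => //.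
- exact: ltNyr.
- by apply: continuous_normal_pdf; rewrite oner_neq0.
Qed.

Lemma Phi_continuous : continuous (@Phi R).
Proof.
by move=> x; apply/differentiable_continuous/derivable1_diffP; have [] := Phi_derivative x.
Qed.

(** The derivative of [Phi] is a positive function. *)
Lemma Phi_lt : {homo @Phi R : x y / x < y}.
Proof.
move=> x y xy; apply: (@gtr0_derive1_lt_cc _ _ x y) => //.
- by move=> z _; have [] := Phi_derivative z.
- by move=> z _; rewrite (Phi_derivative z).2 std_normal_pdf_gt0.
- exact/continuous_subspaceT/Phi_continuous.
- by rewrite in_itv/= lexx ltW.
- by rewrite in_itv/= lexx ltW.
Qed.

(** The density is even, hence [`[0, +oo[] carries half of the total mass, and
    its complement the other half. *)
Lemma Phi0 : @Phi R 0 = 1 / 2.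
Proof.
pose f : R -> R := normal_pdf 0 1.
have intf (i : interval R) : lebesgue_measure.-integrable [set` i] (EFin \o f).
  exact: integrableS (integrable_normal_pdf 0 1).
have half : 1%E = (2%:E * \int[lebesgue_measure]_(x in `[0%R, +oo[) (f x)%:E)%E.
  rewrite -(integral_normal_pdf (0 : R) 1) ge0_symfun_integralT.
  - by rewrite set_itvcy.
  - by move=> x; exact: normal_pdf_ge0.
  - by apply: continuous_normal_pdf; rewrite oner_neq0.
  - by move=> x; rewrite /= normal_pdfE ?oner_neq0// /normal_fun !subr0 sqrrN.
have {}half : 1 = 2 * \int[lebesgue_measure]_(x in `[0, +oo[) f x.
  by rewrite -[LHS]/(fine 1) half fineM//; exact: integrable_fin_num (intf _).
have compl : \int[lebesgue_measure]_(x in `[0, +oo[) f x = 1 - Phi 0.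
  rewrite -Rintegral_itv_obnd_cbnd// -(@Rintegral_itvB _ _ -oo%O)//.
  by rewrite set_itvNyy /Rintegral integral_normal_pdf.
move: half; rewrite {}compl; move: (Phi 0) => y y_half.
lra.
Qed.

(* [Phi] is the distribution function of the identity, seen as a random
   variable on the line equipped with the normal law; the limits of [Phi] at
   infinity are then those of an arbitrary distribution function. *)
Let idT : measurableTypeR R -> R := idfun.

#[local] HB.instance Definition _ :=
  @isMeasurableFun.Build _ _ _ _ idT (@measurable_id _ _ setT).

Let X : {RV (normal_prob (0 : R) 1) >-> R} := idT.

Lemma Phi_cvgy : @Phi R x @[x --> +oo] --> (1 : R).
Proof. exact: (fine_cvg (cvg_cdfy1 X)). Qed.
Lemma Phi_cvgNy : @Phi R x @[x --> -oo] --> (0 : R).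
Proof. exact: (fine_cvg (cvg_cdfNy0 X)). Qed.

Lemma Phibar0 : @Phibar R 0 = 1 / 2.
Proof. rewrite /Phibar Phi0; lra. Qed.

Lemma Phibar_lt x y : (Phibar x < Phibar y) = (y < x).
Proof. by rewrite ltrD2l ltrN2 (leW_mono (le_mono Phi_lt)). Qed.

Lemma Phibar_inj : injective (@Phibar R).
Proof.
move=> x y Phi_xy; have [xy|yx|//] := ltgtP x y.
- by move: xy; rewrite -Phibar_lt Phi_xy ltxx.
- by move: yx; rewrite -Phibar_lt Phi_xy ltxx.
Qed.

(** Intermediate value theorem, between points where [Phi] is close enough to
    its limits [0] and [1]. *)
Lemma Phibar_onto eps : 0 < eps < 1 -> exists x, Phibar x = eps :> R.
Proof.
move=> /andP[eps0 eps1].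
have [a /ltW aeps] : exists a, Phi a < 1 - eps.
  near (-oo : set_system R) => a; exists a; near: a.
  by apply: (cvgr_lt _ Phi_cvgNy); rewrite subr_gt0.
have [b /ltW epsb] : exists b, 1 - eps < Phi b.
  near (+oo : set_system R) => b; exists b; near: b.
  by apply: (cvgr_gt _ Phi_cvgy); rewrite ltrBlDr ltrDl.
have Phi_le : {mono @Phi R : x y / x <= y} := le_mono Phi_lt.
have ab : a <= b by rewrite -Phi_le (le_trans aeps).
have [|x _ Phix] := @IVT R Phi a b (1 - eps) ab (continuous_subspaceT Phi_continuous).
  by rewrite ge_min aeps le_max epsb orbT.
by exists x; rewrite /Phibar Phix subKr.
Unshelve. all: by end_near. Qed.

(** The pseudo-inverse takes the default value [0] outside the range of
    [Phibar]; surjectivity onto the open unit interval rules that case out. *)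
Lemma Phibar_invK eps : 0 < eps < 1 -> Phibar (Phibar_inv eps) = eps :> R.
Proof.
move=> /Phibar_onto[x xeps]; apply: (@pinvK _ _ (fun=> 0) setT (@Phibar R)).
by rewrite inE; exists x.
Qed.

(** This turns the delay equation into an algebraic equation. *)
Lemma Phibar_eq eps x : 0 < eps < 1 -> Phibar x = eps <-> x = Phibar_inv eps.
Proof.
move=> eps01; split => [xeps|->]; last exact: Phibar_invK.
by apply: Phibar_inj; rewrite Phibar_invK.
Qed.

End standard_normal_cdf.

(** * Quadratic equations *)

(** A negative value at [x0] forces the discriminant [A ^+ 2 - 4 * a * B] to
    exceed [(2 * a * x0 - A) ^+ 2]: this gives two roots and puts [x0] strictly
    between them.  The smaller root is positive because the product [B / a]
    and the sum [A / a] of the roots both are. *)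
Lemma quadratic_roots_separated (R : rcfType) (a A B x0 : R) :
  0 < a -> 0 < B -> 0 < x0 -> a * x0 ^+ 2 - A * x0 + B < 0 ->
  let s := Num.sqrt (A ^+ 2 - 4 * a * B) in
  let r1 := (A - s) / (2 * a) in
  let r2 := (A + s) / (2 * a) in
  [/\ 0 < r1 < x0, x0 < r2 &
      forall x, a * x ^+ 2 - A * x + B = 0 <-> x = r1 \/ x = r2].
Proof.
move=> a_gt0 B_gt0 x0_gt0 q_lt0 s r1 r2.
have a2_gt0 : 0 < 2 * a by rewrite mulr_gt0.
have disc_gt : (2 * a * x0 - A) ^+ 2 < A ^+ 2 - 4 * a * B.
  rewrite -subr_gt0.
  have -> : A ^+ 2 - 4 * a * B - (2 * a * x0 - A) ^+ 2
          = 4 * a * - (a * x0 ^+ 2 - A * x0 + B) by ring.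
  by rewrite mulr_gt0 ?oppr_gt0// mulr_gt0.
have disc_gt0 : 0 < A ^+ 2 - 4 * a * B by exact: le_lt_trans (sqr_ge0 _) disc_gt.
have s_gt0 : 0 < s by rewrite sqrtr_gt0.
have s2 : s ^+ 2 = A ^+ 2 - 4 * a * B by rewrite sqr_sqrtr// ltW.
have : `|2 * a * x0 - A| < s.
  by rewrite -(@ltr_pXn2r _ 2) ?nnegrE// ?ltW// s2 real_normK ?num_real.
rewrite ltr_norml => /andP[s_lo s_hi].
have aB_gt0 : 0 < a * B by rewrite mulr_gt0.
have A_gt0 : 0 < A.
  have ax0_gt0 : 0 < a * x0 ^+ 2 by rewrite mulr_gt0// exprn_gt0.
  rewrite -(pmulr_lgt0 _ x0_gt0); lra.
have s_ltA : s < A by rewrite -(@ltr_pXn2r _ 2) ?nnegrE ?ltW// s2; lra.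
have a_neq0 : a != 0 by rewrite gt_eqF.
split.
- rewrite divr_gt0 ?subr_gt0//= ltr_pdivrMr//; lra.
- rewrite ltr_pdivlMr//; lra.
move=> x.
have -> : a * x ^+ 2 - A * x + B = a * ((x - r1) * (x - r2)).
  have -> : B = (A ^+ 2 - s ^+ 2) / (4 * a) by rewrite s2; field.
  rewrite /r1 /r2; field; exact: a_neq0.
split=> [/eqP|[]->]; last 2 first.
- by rewrite subrr mul0r mulr0.
- by rewrite subrr !mulr0.
by rewrite !mulf_eq0 (negbTE a_neq0)/= !subr_eq0 => /orP[] /eqP; [left|right].
Qed.

(** Squaring is reversible here because both sides are negative. *)
Lemma div_sqrt_eq_neg (R : rcfType) (N V z : R) :
  N < 0 -> z < 0 -> 0 < V -> N / Num.sqrt V = z <-> N ^+ 2 = z ^+ 2 * V.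
Proof.
move=> N_lt0 z_lt0 V_gt0.
have sV_gt0 : 0 < Num.sqrt V by rewrite sqrtr_gt0.
have -> : z ^+ 2 * V = (z * Num.sqrt V) ^+ 2 by rewrite exprMn sqr_sqrtr// ltW.
split=> [<-|/eqP]; first by rewrite divfK// gt_eqF.
rewrite eqf_sqr => /orP[/eqP->|/eqP NE]; first by rewrite mulfK// gt_eqF.
have : z * Num.sqrt V < 0 by rewrite nmulr_rlt0.
by rewrite -oppr_gt0 -NE ltNge ltW.
Qed.

(** * The overloaded regime *)

Section overloaded_moments.
Variables (R : realType) (lambda mu theta gamma p : R).
Hypotheses (lambda_gt0 : 0 < lambda) (mu_gt0 : 0 < mu) (theta_gt0 : 0 < theta).
Hypotheses (gamma_gt0 : 0 < gamma) (p_ge0 : 0 <= p) (p_le1 : p <= 1).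

Let kappa := gamma / (gamma + p * mu).
Let U := gamma * p * mu ^+ 2 * (mu * (1 - p) - gamma)
         / (theta * (gamma + p * mu) ^+ 2 * (theta + gamma + p * mu)).
Let cstar := lambda / mu + lambda * p / gamma.
Let over c := overloaded lambda mu theta gamma p c.

Let pmu_ge0 : 0 <= p * mu.
Proof. by rewrite mulr_ge0// ltW. Qed.

Let gpm_gt0 : 0 < gamma + p * mu.
Proof. by rewrite ltr_wpDr. Qed.

Let tgpm_gt0 : 0 < theta + gamma + p * mu.
Proof. by rewrite -addrA addr_gt0. Qed.

(** The means and covariances enter only through these two functions of [c],
    both affine. *)
Lemma overloaded_mean_diff c :
  sstar (over c) - qstar (over c) = (mu * kappa * c - lambda) / theta.
Proof. by rewrite /= /kappa; field; rewrite !gt_eqF. Qed.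

Lemma overloaded_var_diff c : var_diff (over c) = lambda / theta + U * c.
Proof. by rewrite /var_diff /= /U; field; rewrite !gt_eqF. Qed.

Lemma mu_kappa_gt0 : 0 < mu * kappa.
Proof. by rewrite mulr_gt0// divr_gt0. Qed.

(** So [cstar] is where the overloaded mean of [S - Q] vanishes. *)
Lemma cstarE : cstar = lambda / (mu * kappa).
Proof. by rewrite /cstar /kappa; field; rewrite !gt_eqF. Qed.

(** The only possibly negative contribution to the numerator is
    [- p * mu * gamma], which the product
    [(gamma + p * mu) * (theta + gamma + p * mu)] dominates. *)
Lemma overloaded_var_cstar_gt0 : 0 < lambda / theta + U * cstar.
Proof.
have -> : lambda / theta + U * cstar = lambda / theta
    * ((gamma + p * mu) * (theta + gamma + p * mu)
       + p * mu * (mu * (1 - p) - gamma))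
    / ((gamma + p * mu) * (theta + gamma + p * mu)).
  by rewrite /U /cstar; field; rewrite !gt_eqF.
rewrite divr_gt0 ?mulr_gt0 ?invr_gt0//.
(* the negative [- p * mu * gamma] cancels against the expanded product *)
have -> : (gamma + p * mu) * (theta + gamma + p * mu)
          + p * mu * (mu * (1 - p) - gamma)
        = gamma * (theta + gamma) + p * mu * (theta + gamma + p * mu)
          + p * mu * (mu * (1 - p)) by ring.
rewrite -addrA ltr_wpDr//; last by rewrite mulr_gt0// addr_gt0.
apply: addr_ge0; apply: mulr_ge0 => //; first exact: ltW.
by rewrite mulr_ge0 ?subr_ge0// ltW.
Qed.

(** An affine function positive at both ends of an interval is positive
    inside it. *)
Lemma overloaded_var_gt0 c : 0 < c < cstar -> 0 < lambda / theta + U * c.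
Proof.
move=> /andP[c_gt0 c_lt]; have V0_gt0 : 0 < lambda / theta by rewrite divr_gt0.
have [U_ge0|U_lt0] := leP 0 U; first by rewrite ltr_wpDr// mulr_ge0// ltW.
apply: lt_trans overloaded_var_cstar_gt0 _.
by rewrite ltrD2l ltr_nM2l.
Qed.

(** Below [cstar] the mean of [S - Q] is negative, and so is [z] as
    [1 / 2 < eps]: squaring the delay equation loses nothing. *)
Lemma overloaded_delay_quadratic eps c : 1 / 2 < eps -> eps < 1 ->
  0 < c < cstar ->
  let z := Phibar_inv eps in
  delay_equation eps (over c) <->
  mu ^+ 2 * kappa ^+ 2 * c ^+ 2
    - (2 * lambda * mu * kappa + z ^+ 2 * theta ^+ 2 * U) * c
    + lambda * (lambda - theta * z ^+ 2) = 0.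
Proof.
move=> eps_gt eps_lt1 c_in z.
have eps01 : 0 < eps < 1 by rewrite eps_lt1 andbT; lra.
have z_lt0 : z < 0 by rewrite -Phibar_lt Phibar0 Phibar_invK.
have mean_lt0 : (mu * kappa * c - lambda) / theta < 0.
  rewrite pmulr_llt0 ?invr_gt0// subr_lt0 mulrC -ltr_pdivlMr ?mu_kappa_gt0//.
  by rewrite -cstarE; case/andP: c_in.
rewrite /delay_equation overloaded_mean_diff overloaded_var_diff.
rewrite (Phibar_eq _ eps01) (div_sqrt_eq_neg mean_lt0 z_lt0)//; last first.
  exact: overloaded_var_gt0.
have theta_neq0 : theta != 0 by rewrite gt_eqF.
set q := (X in _ <-> X = 0).
have -> : q = theta ^+ 2 * (((mu * kappa * c - lambda) / theta) ^+ 2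
                            - z ^+ 2 * (lambda / theta + U * c)).
  by rewrite /q; field.
split=> [->|/eqP]; first by rewrite subrr mulr0.
by rewrite mulf_eq0 expf_eq0/= (negbTE theta_neq0)/= subr_eq0 => /eqP.
Qed.

(** The quadratic is the square of [theta] times the mean of [S - Q], minus
    [(z * theta) ^+ 2] times the variance; at [cstar] the mean vanishes and
    only the variance term is left. *)
Lemma overloaded_quadratic_cstar_lt0 z : z < 0 ->
  mu ^+ 2 * kappa ^+ 2 * cstar ^+ 2
    - (2 * lambda * mu * kappa + z ^+ 2 * theta ^+ 2 * U) * cstar
    + lambda * (lambda - theta * z ^+ 2) < 0.
Proof.
move=> z_lt0.
have mk_cstar : mu * kappa * cstar = lambda.
  by rewrite cstarE mulrC divfK// gt_eqF// mu_kappa_gt0.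
have -> : mu ^+ 2 * kappa ^+ 2 * cstar ^+ 2
    - (2 * lambda * mu * kappa + z ^+ 2 * theta ^+ 2 * U) * cstar
    + lambda * (lambda - theta * z ^+ 2)
  = (mu * kappa * cstar - lambda) ^+ 2
    - (z * theta) ^+ 2 * (lambda / theta + U * cstar).
  by field; rewrite gt_eqF.
rewrite mk_cstar subrr expr0n/= sub0r oppr_lt0 mulr_gt0//.
  by rewrite exprn_even_gt0//= mulf_eq0 negb_or lt_eqF// gt_eqF.
exact: overloaded_var_cstar_gt0.
Qed.

End overloaded_moments.

(** * The staffing levels *)

Theorem theorem5p2 (R : realType) (lambda mu theta gamma p eps : R)
    (lambda_gt0 : 0 < lambda) (mu_gt0 : 0 < mu) (theta_gt0 : 0 < theta)
    (gamma_gt0 : 0 < gamma) (p_ge0 : 0 <= p) (p_le1 : p <= 1)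
    (eps_gt0 : 0 < eps) (eps_lt1 : eps < 1) :
  let cstar := lambda / mu + lambda * p / gamma in
  let z := Phibar_inv eps in
  let under c := underloaded lambda mu gamma p c in
  let over c := overloaded lambda mu theta gamma p c in
  (eps < 1 / 2 ->
     let c_eps := cstar + z * Num.sqrt cstar in
     [/\ forall c : R, 0 < c -> sstar (under c) - qstar (under c) = c - cstar,
         forall c : R, 0 < c -> var_diff (under c) = cstar,
         forall c : R, 0 < c -> (delay_equation eps (under c) <-> c = c_eps),
         0 < z
       & cstar < c_eps])
  /\
  (1 / 2 < eps ->
     let kappa := gamma / (gamma + p * mu) in
     let U := gamma * p * mu ^+ 2 * (mu * (1 - p) - gamma)
              / (theta * (gamma + p * mu) ^+ 2 * (theta + gamma + p * mu)) in
     let A := 2 * lambda * mu * kappa + z ^+ 2 * theta ^+ 2 * U in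
     let quad c := mu ^+ 2 * kappa ^+ 2 * c ^+ 2
                   - (2 * lambda * mu * kappa + z ^+ 2 * theta ^+ 2 * U) * c
                   + lambda * (lambda - theta * z ^+ 2) in
     let c_eps :=
       (A - Num.sqrt (A ^+ 2 - 4 * mu ^+ 2 * kappa ^+ 2
                               * lambda * (lambda - theta * z ^+ 2)))
       / (2 * mu ^+ 2 * kappa ^+ 2) in
     [/\ forall c : R, 0 < c ->
           sstar (over c) - qstar (over c) = (mu * kappa * c - lambda) / theta,
         forall c : R, 0 < c -> var_diff (over c) = lambda / theta + U * c
       & theta * z ^+ 2 < lambda ->
         [/\ forall c : R, 0 < c < cstar ->
               (delay_equation eps (over c) <-> c = c_eps),
             exists2 c2 : R, c_eps < c2 &
               forall c : R, quad c = 0 <-> c = c_eps \/ c = c2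
           & 0 < c_eps < cstar]]).
Proof.
move=> cstar z under over.
have eps01 : 0 < eps < 1 by rewrite eps_gt0.
have cstar_gt0 : 0 < cstar.
  by rewrite ltr_wpDr ?divr_gt0// divr_ge0 ?mulr_ge0// ltW.
split=> [eps_lt|eps_gt].
  move=> c_eps.
  have meanE c : sstar (under c) - qstar (under c) = c - cstar.
    by rewrite /= /cstar; ring.
  have varE c : var_diff (under c) = cstar.
    by rewrite /var_diff /= /cstar; ring.
  have sqrt_gt0 : 0 < Num.sqrt cstar by rewrite sqrtr_gt0.
  have z_gt0 : 0 < z by rewrite -Phibar_lt Phibar0 Phibar_invK.
  split=> [c _|c _|c _||].
  - exact: meanE.
  - exact: varE.
  - rewrite /delay_equation meanE varE (Phibar_eq _ eps01) -/z /c_eps.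
    have sqrt_neq0 : Num.sqrt cstar != 0 by rewrite gt_eqF.
    split=> [<-|->]; first by rewrite divfK// addrC subrK.
    by rewrite addrC addKr mulfK.
  - exact: z_gt0.
  - by rewrite /c_eps ltrDl mulr_gt0.
move=> kappa U A quad c_eps; split=> [c _|c _|z_small].
- exact: overloaded_mean_diff.
- exact: overloaded_var_diff.
have z_lt0 : z < 0 by rewrite -Phibar_lt Phibar0 Phibar_invK.
have a_gt0 : 0 < mu ^+ 2 * kappa ^+ 2.
  by rewrite -exprMn exprn_gt0// mu_kappa_gt0.
have B_gt0 : 0 < lambda * (lambda - theta * z ^+ 2).
  by rewrite mulr_gt0// subr_gt0.
have q_lt0 : quad cstar < 0 by exact: overloaded_quadratic_cstar_lt0.
have c_epsE : (A - Num.sqrt (A ^+ 2 - 4 * (mu ^+ 2 * kappa ^+ 2)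
                                    * (lambda * (lambda - theta * z ^+ 2))))
              / (2 * (mu ^+ 2 * kappa ^+ 2)) = c_eps.
  by rewrite /c_eps !mulrA.
have := quadratic_roots_separated a_gt0 B_gt0 cstar_gt0 q_lt0.
rewrite /= c_epsE; set c2 := (A + _) / _.
case=> /andP[ceps_gt0 ceps_lt] c2_gt rootsE.
split.
- move=> c c_in.
  rewrite (overloaded_delay_quadratic _ _ _ _ _ _ eps_gt)//.
  (* the larger root lies beyond [cstar], outside the overloaded range *)
  split=> [/rootsE[//|cE]|->]; last by apply/rootsE; left.
  by move: c_in; rewrite cE (ltNge c2) (ltW c2_gt) andbF.
- exists c2; first exact: lt_trans c2_gt.
  exact: rootsE.
- by rewrite ceps_gt0.
Qed.
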